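(* Let $k$ be an infinite field, let $S$ be a numerical semigroup with conductor $c$, and let $E$ be an ideal of $S$ with multiplicity $e=e(E)$. Let $R=k[[S]]$ and let $I=(t^a\mid a\in E)\subseteq R$. Assume that $r(I)=r\ge2$. If $(r-1)e\ge c$, then $h(I)=r$.
   Context: A numerical semigroup is a submonoid $S$ of $(\mathbb N,+)$ with $\mathbb N\setminus S$ finite; its conductor is the smallest integer $c$ such that $c+\mathbb N\subseteq S$. The ring $k[[S]]\subseteq k[[t]]$ consists of the power series whose exponents all lie in $S$. An ideal of $S$ is a non-empty subset $E\subseteq S$ with $E+S\subseteq E$; its multiplicity $e(E)$ is its smallest element. A principal reduction of $I$ is an element $x\in I$ with $I^{n+1}=xI^n$ for some $n\ge0$ (here $x=t^e$ is one), and the reduction number is $r(I)=\min\{n\in\mathbb N\mid I^{n+1}=xI^n\}$, which is independent of the principal reduction $x$. For a regular ideal $L$ of $R$ (one containing a non-zero-divisor), the Ratliff-Rush closure is $\widetilde L=\bigcup_{n\ge1}(L^{n+1}:_RL^n)$, and $h(I)=\min\{n\in\mathbb N_+\mid I^m=\widetilde{I^m}\ \text{for all } m\ge n\}$, where $\mathbb N_+$ is the set of positive integers. *)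

(* Defs.v *)
From HB Require Import structures.
From mathcomp Require Import all_boot all_order all_algebra.
From mathcomp Require Import boolp classical_sets functions cardinality.

Set Implicit Arguments.
Unset Strict Implicit.
Unset Printing Implicit Defensive.

Import GRing.Theory.

Local Open Scope classical_set_scope.
Local Open Scope ring_scope.

Definition is_least (A : set nat) (n : nat) : Prop :=
  A n /\ forall m, A m -> (n <= m)%N.

(** * Formal power series *)

Record fps (k : comNzRingType) := Fps { fps_coef :> nat -> k }.

HB.instance Definition _ (k : comNzRingType) := [isNew for @fps_coef k].
HB.instance Definition _ (k : comNzRingType) := [Choice of fps k by <:].

Section PowerSeriesRing.
Variable k : comNzRingType.
Implicit Types f g h : fps k.

Lemma fpsP f g : (forall n, f n = g n) <-> f = g.
Proof.
by split=> [fg|-> //]; apply/val_inj/funext.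
Qed.

Definition fps_zero : fps k := Fps (fun=> 0).
Definition fps_one : fps k := Fps (fun n => (n == 0)%:R).
Definition fps_opp f : fps k := Fps (fun n => - f n).
Definition fps_add f g : fps k := Fps (fun n => f n + g n).
Definition fps_mul f g : fps k :=
  Fps (fun n => \sum_(i < n.+1) f i * g (n - i)%N).

Fact fps_addA : associative fps_add.
Proof. by move=> f g h; apply/fpsP => n /=; rewrite addrA. Qed.

Fact fps_addC : commutative fps_add.
Proof. by move=> f g; apply/fpsP => n /=; rewrite addrC. Qed.

Fact fps_add0 : left_id fps_zero fps_add.
Proof. by move=> f; apply/fpsP => n /=; rewrite add0r. Qed.

Fact fps_addN : left_inverse fps_zero fps_opp fps_add.
Proof. by move=> f; apply/fpsP => n /=; rewrite addNr. Qed.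

HB.instance Definition _ :=
  GRing.isZmodule.Build (fps k) fps_addA fps_addC fps_add0 fps_addN.

Definition fps_trunc (N : nat) f : {poly k} := \poly_(i < N.+1) f i.

Lemma coef_fps_trunc N f i : (i <= N)%N -> (fps_trunc N f)`_i = f i.
Proof. by move=> iN; rewrite coef_poly ltnS iN. Qed.

Lemma fps_mul_trunc N f g n : (n <= N)%N ->
  fps_mul f g n = (fps_trunc N f * fps_trunc N g)`_n.
Proof.
move=> nN; rewrite coefM; apply: eq_bigr => i _.
by rewrite !coef_fps_trunc ?(leq_trans _ nN) ?leq_subr // -ltnS.
Qed.

Fact fps_mulA : associative fps_mul.
Proof.
move=> f g h; apply/fpsP => n.
transitivity ((fps_trunc n f * (fps_trunc n g * fps_trunc n h))`_n).
  rewrite coefM; apply: eq_bigr => i _.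
  by rewrite (@fps_mul_trunc n) ?leq_subr // coef_fps_trunc // -ltnS.
rewrite mulrA coefM; apply: eq_bigr => i _.
by rewrite (@fps_mul_trunc n) ?coef_fps_trunc ?leq_subr // -ltnS.
Qed.

Fact fps_mulC : commutative fps_mul.
Proof.
by move=> f g; apply/fpsP => n; rewrite !(@fps_mul_trunc n) // mulrC.
Qed.

Fact fps_mul1 : left_id fps_one fps_mul.
Proof.
move=> f; apply/fpsP => n /=.
rewrite big_ord_recl /= mul1r subn0 big1 ?addr0 // => i _.
by rewrite mul0r.
Qed.

Fact fps_mulD : left_distributive fps_mul fps_add.
Proof.
move=> f g h; apply/fpsP => n /=; rewrite -big_split /=.
by apply: eq_bigr => i _; rewrite mulrDl.
Qed.

Fact fps_one_neq0 : fps_one != 0.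
Proof. by apply/eqP => /fpsP/(_ 0)/eqP; rewrite /= oner_eq0. Qed.

HB.instance Definition _ := GRing.Zmodule_isComNzRing.Build (fps k)
  fps_mulA fps_mulC fps_mul1 fps_mulD fps_one_neq0.

Definition fps_monomial (a : nat) : fps k := Fps (fun n => (n == a)%:R).

End PowerSeriesRing.

(** * Numerical semigroups *)

Record numerical_semigroup := NumericalSemigroup {
  ns_set : set nat;
  ns_0 : ns_set 0%N;
  ns_add : forall a b, ns_set a -> ns_set b -> ns_set (a + b)%N;
  ns_cofinite : finite_set (~` ns_set) }.

Definition is_conductor (S : numerical_semigroup) : nat -> Prop :=
  is_least [set c | forall n, ns_set S (c + n)%N].

Definition is_semigroup_ideal (S : numerical_semigroup) (E : set nat) : Prop :=
  [/\ E !=set0, E `<=` ns_set S & forall a s, E a -> ns_set S s -> E (a + s)%N].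

Definition is_multiplicity (E : set nat) : nat -> Prop := is_least E.

(** * The semigroup ring k[[S]] *)

Definition supported_in (k : comNzRingType) (S : numerical_semigroup) :
    {pred fps k} :=
  fun f => `[< forall n, f n != 0 -> ns_set S n >].

Section SupportedIn.
Variables (k : comNzRingType) (S : numerical_semigroup).

Fact supported_in_subring : subring_closed (@supported_in k S).
Proof.
split=> [|f g /asboolP fS /asboolP gS|f g /asboolP fS /asboolP gS];
  apply/asboolP => n /=.
- by case: n => [|n] /=; rewrite ?eqxx // => _; apply: ns_0.
- have [f0|/fS //] := eqVneq (f n) 0.
  by rewrite f0 add0r oppr_eq0 => /gS.
- apply: contra_neqP => nS; apply: big1 => i _.
  have [-> |/fS iS] := eqVneq (f i) 0; first by rewrite mul0r.
  have [-> |/gS niS] := eqVneq (g (n - i)%N) 0; first by rewrite mulr0.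
  case: nS; rewrite -(@subnKC i n) -1?ltnS ?ltn_ord //.
  exact: ns_add.
Qed.

HB.instance Definition _ :=
  GRing.isSubringClosed.Build (fps k) (@supported_in k S) supported_in_subring.

End SupportedIn.

Record semigroup_ring (k : comNzRingType) (S : numerical_semigroup) :=
  SemigroupRing {
    fps_of_semigroup_ring :> fps k;
    _ : fps_of_semigroup_ring \in @supported_in k S }.

HB.instance Definition _ (k : comNzRingType) (S : numerical_semigroup) :=
  [isSub for @fps_of_semigroup_ring k S].
HB.instance Definition _ (k : comNzRingType) (S : numerical_semigroup) :=
  [Choice of semigroup_ring k S by <:].
HB.instance Definition _ (k : comNzRingType) (S : numerical_semigroup) :=
  [SubChoice_isSubComNzRing of semigroup_ring k S by <:].

(** * Ideals of a commutative ring *)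

(* The unit ideal is allowed, unlike in [idealr] from [ring_quotient]. *)
Definition is_ideal (R : comNzRingType) (J : set R) : Prop :=
  [/\ J 0, forall x y, J x -> J y -> J (x + y)
    & forall a x, J x -> J (a * x)].

Definition ideal_gen (R : comNzRingType) (A : set R) : set R :=
  smallest (@is_ideal R) A.

Definition ideal_mul (R : comNzRingType) (I J : set R) : set R :=
  ideal_gen [set x * y | x in I & y in J].

Definition ideal_exp (R : comNzRingType) (I : set R) (n : nat) : set R :=
  iter n (ideal_mul I) setT.

Definition elt_mul (R : comNzRingType) (x : R) (J : set R) : set R :=
  [set x * y | y in J].

Definition ideal_colon (R : comNzRingType) (I J : set R) : set R :=
  [set x | elt_mul x J `<=` I].

Definition is_principal_reduction (R : comNzRingType) (I : set R) (x : R) :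
    Prop :=
  I x /\ exists n, ideal_exp I n.+1 = elt_mul x (ideal_exp I n).

(* Where the minimum does not depend on [x], asking for some principal
   reduction [x] is the same as asking for all of them. *)
Definition is_reduction_number (R : comNzRingType) (I : set R) (r : nat) :
    Prop :=
  exists2 x, is_principal_reduction I x &
    is_least [set n | ideal_exp I n.+1 = elt_mul x (ideal_exp I n)] r.

(* Meaningful for regular ideals only. *)
Definition ratliff_rush (R : comNzRingType) (L : set R) : set R :=
  \bigcup_(n in [set n | (1 <= n)%N])
    ideal_colon (ideal_exp L n.+1) (ideal_exp L n).

Definition is_ratliff_rush_index (R : comNzRingType) (I : set R) :
    nat -> Prop :=
  is_least [set n | (0 < n)%N /\
    forall m, (n <= m)%N -> ideal_exp I m = ratliff_rush (ideal_exp I m)].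

(* If [E] is an ideal of [S], every t^a with a in [E] lies in k[[S]], so no
   generator is lost by quantifying over [semigroup_ring k S]. *)
Definition monomial_ideal (k : comNzRingType) (S : numerical_semigroup)
    (E : set nat) : set (semigroup_ring k S) :=
  ideal_gen [set f : semigroup_ring k S |
    exists2 a, E a & fps_of_semigroup_ring f = fps_monomial k a].
Arguments monomial_ideal k S E : clear implicits.

(* Main.v *)
Require Import Defs.
From mathcomp Require Import all_boot all_order all_algebra.
From mathcomp Require Import boolp classical_sets functions cardinality.

(** Let x be a principal reduction of I with reduction number r.  For m >= r we
    have I^(m+j) = x^j I^m, and cancelling powers of x shows that I^m is
    Ratliff-Rush closed.  For m = r-1, choose f in I^r outside x I^(r-1).  The
    order of x is exactly e, so g = f/x exists in k[[t]] and has order at least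
    (r-1)e >= c; hence g lies in k[[S]].  Then g is not in I^(r-1), although
    g I^N = f I^(N-1) is contained in I^(N+r-1) for N > r, so that g is in the
    Ratliff-Rush closure of I^(r-1). *)

Set Implicit Arguments.
Unset Strict Implicit.
Unset Printing Implicit Defensive.

Import GRing.Theory.

Local Open Scope classical_set_scope.
Local Open Scope ring_scope.

(** * Products and powers of ideals in a commutative ring *)

Section Ideals.
Variable R : comNzRingType.
Implicit Types (A I J K : set R) (x y z : R).

Lemma ideal_gen_is_ideal A : is_ideal (ideal_gen A).
Proof.
split=> [J [[J0 _ _] _] //|x y Ax Ay J JA|a x Ax J JA].
- by have [[_ JD _] _] := JA; apply: JD; [apply: Ax | apply: Ay].
- by have [[_ _ JM] _] := JA; apply: JM; apply: Ax.
Qed.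

Lemma sub_ideal_gen A : A `<=` ideal_gen A.
Proof. exact: sub_smallest. Qed.

Lemma ideal_gen_sub A J : is_ideal J -> A `<=` J -> ideal_gen A `<=` J.
Proof. by move=> idJ AJ; apply: smallest_sub. Qed.

Lemma ideal_mul_mem I J x y : I x -> J y -> ideal_mul I J (x * y).
Proof. by move=> Ix Jy; apply: sub_ideal_gen; exists x => //; exists y. Qed.

Lemma ideal_mul_sub I J K : is_ideal K ->
  (forall x y, I x -> J y -> K (x * y)) -> ideal_mul I J `<=` K.
Proof.
by move=> idK IJK; apply: ideal_gen_sub => // _ [x Ix [y Jy <-]]; apply: IJK.
Qed.

(** Allows a claim about [z * y], with [z] fixed and [y] in a generated ideal, to be checked on
    generators only. *)
Lemma ideal_preim_mul J z : is_ideal J -> is_ideal [set y | J (z * y)].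
Proof.
case=> J0 JD JM; split=> /= [|x y Jx Jy|a x Jx].
- by rewrite mulr0.
- by rewrite mulrDr; apply: JD.
- by rewrite mulrCA; apply: JM.
Qed.

Lemma elt_mul_is_ideal x J : is_ideal J -> is_ideal (elt_mul x J).
Proof.
case=> J0 JD JM; split=> [|_ _ [y Jy <-] [z Jz <-]|a _ [y Jy <-]].
- by exists 0 => //; rewrite mulr0.
- by exists (y + z); [apply: JD | rewrite mulrDr].
- by exists (a * y); [apply: JM | rewrite mulrCA].
Qed.

Lemma ideal_exp_is_ideal I n : is_ideal (ideal_exp I n).
Proof. by case: n => [|n]; [split | apply: ideal_gen_is_ideal]. Qed.

Lemma ideal_exp_mulD I a b x y :
  ideal_exp I a x -> ideal_exp I b y -> ideal_exp I (a + b)%N (x * y).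
Proof.
move=> + Ib; elim: a x => [|a IH] x Ia.
  by have [_ _ M] := ideal_exp_is_ideal I b; apply: M.
rewrite mulrC; move: x Ia; apply: ideal_mul_sub.
  exact/ideal_preim_mul/ideal_exp_is_ideal.
move=> u v Iu Iv /=; rewrite mulrC -mulrA.
by apply: ideal_mul_mem => //; apply: IH.
Qed.

Lemma ideal_expD_sub I a b :
  ideal_exp I (a + b)%N `<=` ideal_mul (ideal_exp I a) (ideal_exp I b).
Proof.
elim: a => [|a IH] y.
  by move=> Iy; rewrite -(mul1r y); apply: ideal_mul_mem.
move: y; apply: ideal_mul_sub; first exact: ideal_gen_is_ideal.
move=> u w Iu /IH; move: w; apply: ideal_mul_sub.
  exact/ideal_preim_mul/ideal_gen_is_ideal.
move=> v y Iv Iy /=; rewrite mulrA.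
by apply: ideal_mul_mem => //; apply: ideal_mul_mem.
Qed.

Lemma ideal_mulS I J K : J `<=` K -> ideal_mul I J `<=` ideal_mul I K.
Proof.
move=> JK; apply: ideal_mul_sub; first exact: ideal_gen_is_ideal.
by move=> x y Ix /JK; apply: ideal_mul_mem.
Qed.

Lemma ideal_expM I m n : ideal_exp (ideal_exp I m) n = ideal_exp I (m * n)%N.
Proof.
elim: n => [|n IH]; first by rewrite muln0.
rewrite mulnS; apply/seteqP; split.
  apply: ideal_mul_sub; first exact: ideal_exp_is_ideal.
  by move=> x y Ix Iy; apply: ideal_exp_mulD => //; rewrite -IH.
by apply: subset_trans (@ideal_expD_sub I m (m * n)%N) _; rewrite -IH.
Qed.

Lemma ideal_exp_pow I x n : I x -> ideal_exp I n (x ^+ n).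
Proof. by move=> Ix; elim: n => // n; rewrite exprS; apply: ideal_mul_mem. Qed.

(** * Powers beyond the reduction number and their Ratliff-Rush closures *)

Section Reduction.
Variables (I : set R) (x : R) (r : nat).
Hypothesis (Ix : I x) (Ir : ideal_exp I r.+1 = elt_mul x (ideal_exp I r)).

Lemma reduction_exp n : (r <= n)%N ->
  ideal_exp I n.+1 = elt_mul x (ideal_exp I n).
Proof.
(* Induction on [n - r]: if the next power is x times the previous one, multiplying by I and moving
   x to the front preserves this. *)
move/subnK <-; elim: (n - r)%N => // d IH; rewrite addSn.
apply/seteqP; split; last by move=> _ [y Iy <-]; apply: ideal_mul_mem.
apply: ideal_mul_sub; first exact/elt_mul_is_ideal/ideal_exp_is_ideal.
move=> u w Iu Iw.
have [v Iv <-] : elt_mul x (ideal_exp I (d + r)) w by rewrite -IH.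
by exists (u * v); [apply: ideal_mul_mem | rewrite mulrCA].
Qed.

Lemma reduction_expD m j : (r <= m)%N ->
  ideal_exp I (m + j)%N `<=` elt_mul (x ^+ j) (ideal_exp I m).
Proof.
move=> rm; elim: j => [|j IH] y; first by exists y; rewrite ?mul1r -1?(addn0 m).
rewrite addnS reduction_exp ?(leq_trans rm) ?leq_addr //.
move=> -[z /IH [w Iw <-] <-].
by exists w; rewrite // exprS mulrA.
Qed.

Lemma ratliff_rush_exp m : GRing.lreg x -> (r <= m)%N ->
  ideal_exp I m = ratliff_rush (ideal_exp I m).
Proof.
move=> regx rm; apply/seteqP; split=> [f If|f [n _ If]].
  by exists 1%N => // _ [y Iy <-]; apply: ideal_mul_mem.
(* The colon condition is tested on the single element x^(mn) of (I^m)^n; the product then lies in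
   x^(mn) I^m. *)
have /reduction_expD : ideal_exp I (m + m * n)%N (f * x ^+ (m * n)).
  rewrite -mulnS -ideal_expM; apply: If; rewrite ideal_expM.
  by exists (x ^+ (m * n)) => //; apply: ideal_exp_pow.
move=> /(_ rm) [y Iy]; rewrite [f * _]mulrC.
by move=> /(lregX regx) <-.
Qed.

Lemma ratliff_rush_quotient m g : (0 < m)%N ->
  ideal_exp I m.+1 (x * g) -> ratliff_rush (ideal_exp I m) g.
Proof.
(* The exponent [r.+1] gives m(r+1) = N+1 with N >= r, as m > 0. So y = xz with z in I^N, and gy =
   (xg)z lies in I^(m+1) I^N. *)
move=> m0 Ixg; exists r.+1 => // _ [y + <-]; rewrite !ideal_expM.
have [N NE rN] : exists2 N, (m * r.+1 = N.+1)%N & (r <= N)%N.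
  have: (r.+1 <= m * r.+1)%N by rewrite leq_pmull.
  by case: (m * r.+1)%N => // N; exists N.
rewrite (mulnS m r.+1) NE reduction_exp // => -[z Iz <-].
rewrite mulrCA mulrA addnS -addSn.
exact: ideal_exp_mulD.
Qed.

End Reduction.
End Ideals.

(** * Order of a power series, shifts and inverses *)

Section Order.
Variable k : comNzRingType.
Implicit Types f g : fps k.

Definition order_ge (d : nat) : set (fps k) :=
  [set f | forall i, (i < d)%N -> f i = 0].

Lemma coef_fps_mul f g n : (f * g) n = \sum_(i < n.+1) f i * g (n - i)%N.
Proof. by []. Qed.

Lemma order_geD d f g : order_ge d f -> order_ge d g -> order_ge d (f + g).
Proof. by move=> fd gd i id; rewrite /= fd // gd // addr0. Qed.

Lemma order_geM a b f g :
  order_ge a f -> order_ge b g -> order_ge (a + b) (f * g).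
Proof.
move=> fa gb n nab; rewrite coef_fps_mul big1 // => i _.
have [ia|ai] := ltnP i a; first by rewrite fa // mul0r.
rewrite gb ?mulr0 // ltn_subLR; last by rewrite -ltnS.
by apply: leq_trans nab _; rewrite leq_add2r.
Qed.

Lemma coef_order_geM a b f g :
  order_ge a f -> order_ge b g -> (f * g) (a + b)%N = f a * g b.
Proof.
move=> fa gb; rewrite coef_fps_mul.
have aP : (a < (a + b).+1)%N by rewrite ltnS leq_addr.
rewrite (bigD1 (Ordinal aP)) //= addKn big1 ?addr0 // => i ia.
have [ia'|ai] := ltnP i a; first by rewrite fa // mul0r.
rewrite gb ?mulr0 // ltn_subLR; last by rewrite -ltnS.
rewrite ltn_add2r ltn_neqAle ai andbT.
by apply: contraNneq ia => aE; apply/eqP/val_inj.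
Qed.

Lemma order_ge_pow f n : f 0%N = 0 -> order_ge n (f ^+ n).
Proof.
move=> f0; elim: n => [|n IH] //; rewrite exprS -add1n.
by apply: order_geM => //; case.
Qed.

(** Division by t^d, discarding the terms of degree below [d]. *)
Definition fps_shift (d : nat) f : fps k := Fps (fun n => f (d + n)%N).

Lemma fps_monomial_order d : order_ge d (fps_monomial k d).
Proof. by move=> i id; rewrite /= ltn_eqF. Qed.

Lemma coef_fps_monomialM d f n : (fps_monomial k d * f) (d + n)%N = f n.
Proof.
have dP : (d < (d + n).+1)%N by rewrite ltnS leq_addr.
rewrite coef_fps_mul (bigD1 (Ordinal dP)) //= eqxx mul1r addKn.
rewrite big1 ?addr0 // => i id.
by rewrite (negPf (_ : i != d :> nat)) ?mul0r.
Qed.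

Lemma fps_shiftK d f : order_ge d f -> f = fps_monomial k d * fps_shift d f.
Proof.
move=> fd; apply/fpsP => n.
have [nd|/subnKC <-] := ltnP n d; last by rewrite coef_fps_monomialM.
rewrite fd // (@order_geM d 0%N) ?addn0 //; exact: fps_monomial_order.
Qed.

Lemma fps_monomialD a b :
  fps_monomial k (a + b) = fps_monomial k a * fps_monomial k b.
Proof.
rewrite [LHS](@fps_shiftK a); last first.
  by move=> i ia; rewrite /= ltn_eqF // ltn_addr.
by congr (_ * _); apply/fpsP => n; rewrite /= eqn_add2l.
Qed.

(* The inverse is the geometric series in w = 1 - f, truncated degree by
   degree since w^j has order at least j. *)
Lemma fps_inverse f : f 0%N = 1 -> exists g, f * g = 1.
Proof.
move=> f0; pose w := 1 - f.
have w0 : w 0%N = 0 by rewrite /w /= f0 subrr.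
pose s n : fps k := \sum_(j < n) w ^+ j.
have sE n m : (n < m)%N -> s m n = s n.+1 n.
  move/subnKC <-; elim: (m - n.+1)%N => [|p IH]; first by rewrite addn0.
  rewrite addnS /s big_ord_recr -/(s (n.+1 + p)%N) -IH /=.
  by rewrite order_ge_pow ?addr0 // addSn ltnS leq_addr.
exists (Fps (fun n => s n.+1 n)); apply/fpsP => n.
transitivity ((f * s n.+1) n).
  by apply: eq_bigr => i _ /=; rewrite [in RHS]sE // ltnS leq_subr.
have -> : f * s n.+1 = 1 - w ^+ n.+1.
  rewrite -[1 in RHS](expr1n _ n.+1) subrXX /w opprB addrC subrK.
  by congr (_ * _); apply: eq_bigr => i _; rewrite expr1n mul1r.
by rewrite /= order_ge_pow // subr0.
Qed.

End Order.

(** * Division in k[[t]] over a field *)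

Section Division.
Variable k : fieldType.
Implicit Types f g x : fps k.

Lemma fps_inverse_field f : f 0%N != 0 -> exists g, f * g = 1.
Proof.
(* The constant series [a] rescales f to constant term 1. *)
move=> f0; pose a : fps k := Fps (fun n => (f 0%N)^-1 *+ (n == 0)%N).
have [|g fg] := @fps_inverse k (f * a); last by exists (a * g); rewrite mulrA.
by rewrite coef_fps_mul big_ord1 /= mulr1n mulfV.
Qed.

(** Write x = t^e u with u a unit and f = t^(e+d) h; then g = t^d h u^(-1). *)
Lemma fps_division d e f x : order_ge e x -> x e != 0 ->
  order_ge (e + d) f -> exists2 g, order_ge d g & f = x * g.
Proof.
move=> xe xe0 fd.
have [|v uv] := @fps_inverse_field (fps_shift e x); first by rewrite /= addn0.
exists (fps_monomial k d * (fps_shift (e + d) f * v)).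
  rewrite -[X in order_ge X]addn0; apply: order_geM => //.
  exact: fps_monomial_order.
rewrite [in RHS](fps_shiftK xe).
rewrite mulrACA -fps_monomialD [in RHS](mulrCA (fps_shift e x)) uv mulr1.
exact: fps_shiftK.
Qed.

(** The inverse of the unit part turns x into t^e, and multiplying by t^e merely shifts
    coefficients. *)
Lemma fps_lreg e x : order_ge e x -> x e != 0 -> GRing.lreg x.
Proof.
move=> xe xe0; have [|v uv] := @fps_inverse_field (fps_shift e x).
  by rewrite /= addn0.
have xv : v * x = fps_monomial k e.
  by rewrite [x](fps_shiftK xe) mulrCA [v * _]mulrC uv mulr1.
move=> f g /(congr1 ( *%R v)); rewrite !mulrA xv => fg; apply/fpsP => n.
by rewrite -(coef_fps_monomialM e f) fg coef_fps_monomialM.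
Qed.

End Division.

(** * Orders, monomial ideals and division in k[[S]] *)

Section SemigroupRing.
Variables (k : fieldType) (S : numerical_semigroup).
Implicit Types f g x : semigroup_ring k S.

Lemma val_semigroup_ringM f g :
  fps_of_semigroup_ring (f * g) = (f : fps k) * (g : fps k).
Proof. exact: (rmorphM (val : semigroup_ring k S -> fps k)). Qed.

Lemma monomial_semigroup_ring a : ns_set S a ->
  {t : semigroup_ring k S | fps_of_semigroup_ring t = fps_monomial k a}.
Proof.
move=> Sa; suff tP : fps_monomial k a \in @supported_in k S.
  by exists (SemigroupRing tP).
by apply/asboolP => n /=; case: (n =P a) => [-> //|_]; rewrite eqxx.
Qed.

Lemma order_ge_is_ideal d :
  is_ideal [set f : semigroup_ring k S | order_ge d (f : fps k)].
Proof.
split=> [i _ //|f g|a f fd]; first exact: order_geD.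
by rewrite /mkset val_semigroup_ringM -[X in order_ge X]add0n; apply: order_geM.
Qed.

Lemma ideal_exp_order_ge (I : set (semigroup_ring k S)) e n f :
  (forall g, I g -> order_ge e (g : fps k)) ->
  ideal_exp I n f -> order_ge (n * e) (f : fps k).
Proof.
move=> Ie; elim: n f => [//|n IH].
apply: ideal_mul_sub; first exact: order_ge_is_ideal.
move=> u v /Ie ue /IH ve; rewrite /mkset val_semigroup_ringM mulSn.
exact: order_geM.
Qed.

Lemma monomial_ideal_order_ge E e f : is_multiplicity E e ->
  monomial_ideal k S E f -> order_ge e (f : fps k).
Proof.
move=> [_ Emin]; move: f; apply: (ideal_gen_sub (order_ge_is_ideal e)).
move=> g [a Ea gE] /= i ie; rewrite gE.
exact: fps_monomial_order (leq_trans ie (Emin _ Ea)).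
Qed.

Lemma semigroup_ring_lreg e x :
  order_ge e (x : fps k) -> x e != 0 -> GRing.lreg x.
Proof.
move=> xe xe0 f g /(congr1 (@fps_of_semigroup_ring k S)).
by rewrite !val_semigroup_ringM => /(fps_lreg xe xe0)/val_inj.
Qed.

(* Compare the coefficients of t^((n+1)e), which lies in I^(n+1) = x I^n. *)
Lemma principal_reduction_coef_neq0 E e x n : E `<=` ns_set S ->
  is_multiplicity E e -> monomial_ideal k S E x ->
  ideal_exp (monomial_ideal k S E) n.+1 =
    elt_mul x (ideal_exp (monomial_ideal k S E) n) ->
  x e != 0.
Proof.
move=> ES Ee Ix In; have [Ee' _] := Ee.
have [t tE] := monomial_semigroup_ring (ES _ Ee').
have It : monomial_ideal k S E t by apply: sub_ideal_gen; exists e.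
have tn m : fps_of_semigroup_ring (t ^+ m) = fps_monomial k (m * e).
  elim: m => [|m IH]; first by apply/fpsP.
  by rewrite exprS val_semigroup_ringM tE IH mulSn fps_monomialD.
have := ideal_exp_pow n.+1 It; rewrite In => -[y Iy xy].
have Ie g := @monomial_ideal_order_ge E e g Ee.
(* Here t^((n+1)e) = xy with y of order at least ne, so the coefficients satisfy x_e y_(ne) = 1. *)
have := coef_order_geM (Ie _ Ix) (ideal_exp_order_ge Ie Iy).
rewrite -val_semigroup_ringM xy tn mulSn /= eqxx => xyE.
by apply: contra_eq_neq xyE => ->; rewrite mul0r oner_eq0.
Qed.

(** The quotient in k[[t]] has only exponents at least d >= c, and these all belong to S. *)
Lemma semigroup_ring_division c d e f x : is_conductor S c -> (c <= d)%N ->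
  order_ge e (x : fps k) -> x e != 0 -> order_ge (e + d) (f : fps k) ->
  exists g, f = x * g.
Proof.
move=> [Sc _] cd xe xe0 fd; have [g gd fE] := fps_division xe xe0 fd.
have gP : g \in @supported_in k S.
  apply/asboolP => n gn; have dn : (d <= n)%N.
    by rewrite leqNgt; apply: contraNN gn => nd; rewrite gd.
  by rewrite -(subnKC (leq_trans cd dn)); apply: Sc.
by exists (SemigroupRing gP); apply: val_inj; rewrite /= fE.
Qed.

End SemigroupRing.

Theorem proposition4p6 (k : fieldType) (k_infinite : infinite_set [set: k]%classic)
  (S : numerical_semigroup) (c : nat) (c_conductor : is_conductor S c)
  (E : set nat) (E_ideal : is_semigroup_ideal S E)
  (e : nat) (e_mult : is_multiplicity E e)
  (r : nat) (r_red : is_reduction_number (monomial_ideal k S E) r)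
  (r_ge2 : (2 <= r)%N) (bound : (c <= (r - 1) * e)%N) :
  is_ratliff_rush_index (monomial_ideal k S E) r.
Proof.
case: r_red => x [Ix _] [Ir rmin]; case: E_ideal => _ ES _.
have xe := monomial_ideal_order_ge e_mult Ix.
have xe0 := principal_reduction_coef_neq0 ES e_mult Ix Ir.
have xreg := semigroup_ring_lreg xe xe0.
split=> [|n [n0 RRn]].
  split=> [|m]; first exact: ltnW.
  exact: (ratliff_rush_exp Ix Ir xreg).
rewrite leqNgt; apply/negP => nr.
(* With r = m+1, the assumption n < r makes I^m Ratliff-Rush closed; the aim is I^(m+1) = x I^m,
   against the minimality of r. *)
case: r r_ge2 bound Ir rmin nr => // m m0; rewrite subn1 => cm Ir rmin nm.
suff /rmin : ideal_exp (monomial_ideal k S E) m.+1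
    = elt_mul x (ideal_exp (monomial_ideal k S E) m) by rewrite ltnn.
apply/seteqP; split=> [f If|_ [y Iy <-]]; last exact: ideal_mul_mem.
(* Elements of I^(m+1) have order at least (m+1)e, so dividing by x leaves order at least me >=
   c. *)
have fd : order_ge (e + m * e) (f : fps k).
  rewrite -mulSn; apply: ideal_exp_order_ge If => g.
  exact: monomial_ideal_order_ge.
have [g fE] := semigroup_ring_division c_conductor cm xe xe0 fd.
(* As xg lies in I^(m+1), g is in the closure of I^m, hence in I^m itself. *)
rewrite fE in If *; exists g => //; rewrite (RRn m nm).
exact: (ratliff_rush_quotient Ix Ir m0 If).
Qed.
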